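(* Let $\mathcal S(\lambda,\bar c,\bar p)$ be an iterated function scheme of similarities and let $\mu_\lambda$ be its unique stationary measure. Then for every $\alpha$ with $0<\alpha<D_2(\mu_\lambda)$ there exist an admissible compact interval $J$ and a piecewise constant function $\psi:\mathbb R\to[0,\infty)$ which vanishes outside $J$ and which on $J$ is positive and bounded away from $0$ and from infinity, such that for every $x\in J$ $$[\mathcal D^{(2)}_{\alpha,\mathcal S}\psi](x)<\psi(x).$$
   Context: An iterated function scheme of similarities $\mathcal S(\lambda,\bar c,\bar p)$ consists of $0<\lambda<1$, $\bar c=(c_1,\dots,c_k)\in\mathbb R^k$ and a probability vector $\bar p=(p_1,\dots,p_k)$ with $0<p_j<1$, $\sum_j p_j=1$; its maps are $f_j(x)=\lambda x+c_j$, $1\le j\le k$. Its stationary measure is the unique Borel probability measure $\mu$ on $\mathbb R$ with $\mu=\sum_{j=1}^k p_j (f_j)_*\mu$. An interval $J$ is ($\lambda$-)admissible for $\mathcal S$ if there is a (nonempty) interval $J_\lambda\subset\mathbb R$ with $f_j(J_\lambda)\subset J_\lambda$ for all $j$ such that the interior of $J$ contains the closure of $\{x-y\mid x,y\in J_\lambda\}$. The symmetric diffusion operator acts on functions $\psi:\mathbb R\to\mathbb R$ by $$[\mathcal D^{(2)}_{\alpha,\mathcal S}\psi](x)=\lambda^{-\alpha}\sum_{i,j=1}^k p_ip_j\,\psi\left(\frac{x-c_i+c_j}{\lambda}\right).$$ A function is piecewise constant on $J$ if it is constant on each element of some finite partition of $J$ into intervals. The correlation dimension of a Borel probability measure $\mu$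 on $\mathbb R$ is $D_2(\mu)=\sup\{\alpha\mid I(\mu,\alpha)<+\infty\}$, where $I(\mu,\alpha)=\int_{\mathbb R}\int_{\mathbb R}|x-y|^{-\alpha}\,\mu(dx)\,\mu(dy)$ (with $0^{-\alpha}=+\infty$ for $\alpha>0$). *)

(* Defs.v *)
From HB Require Import structures.
From mathcomp Require Import all_boot all_order all_algebra.
From mathcomp Require Import all_classical all_reals all_analysis.

Set Implicit Arguments.
Unset Strict Implicit.
Unset Printing Implicit Defensive.

Import Order.TTheory GRing.Theory Num.Theory.
Import numFieldNormedType.Exports.

Local Open Scope classical_set_scope.
Local Open Scope ring_scope.

Record similarity_ifs (R : realType) (k : nat) := SimilarityIFS {
  ifs_ratio : R;
  ifs_shift : 'I_k -> R;
  ifs_weight : 'I_k -> R;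
  ifs_ratio_gt0 : 0 < ifs_ratio;
  ifs_ratio_lt1 : ifs_ratio < 1;
  ifs_weight_gt0 : forall j, 0 < ifs_weight j;
  ifs_weight_lt1 : forall j, ifs_weight j < 1;
  ifs_weight_sum1 : \sum_(j < k) ifs_weight j = 1
}.

Definition ifs_map (R : realType) (k : nat) (S : similarity_ifs R k)
  (j : 'I_k) (x : R) : R := ifs_ratio S * x + ifs_shift S j.

(* The sigma-algebra of measurableTypeR R is the Borel one (RGenOpens).
   Existence and uniqueness of the stationary measure of a similarity_ifs are
   Hutchinson's theorem, so "the stationary measure" is any mu satisfying
   this predicate. *)
Definition stationary_measure (R : realType) (k : nat)
    (S : similarity_ifs R k) (mu : probability (measurableTypeR R) R) : Prop :=
  forall A : set (measurableTypeR R), measurable A ->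
    mu A = (\sum_(j < k) (ifs_weight S j)%:E *
      pushforward mu (ifs_map S j : measurableTypeR R -> measurableTypeR R) A)%E.

(* is_interval is order-convexity: it covers open, closed, half-open and
   unbounded intervals, and also the empty set. *)
Definition admissible (R : realType) (k : nat) (S : similarity_ifs R k)
    (J : set R) : Prop :=
  is_interval J /\
  exists Jl : set R,
    [/\ is_interval Jl, Jl !=set0,
        forall j, ifs_map S j @` Jl `<=` Jl &
        closure [set x - y | x in Jl & y in Jl] `<=` interior J].

Definition sym_diffusion (R : realType) (k : nat) (alpha : R)
    (S : similarity_ifs R k) (psi : R -> R) (x : R) : R :=
  ifs_ratio S `^ (- alpha) *
  \sum_(i < k) \sum_(j < k)
    ifs_weight S i * ifs_weight S j *
    psi ((x - ifs_shift S i + ifs_shift S j) / ifs_ratio S).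

Definition piecewise_constant_on (R : realType) (J : set R) (psi : R -> R) :
    Prop :=
  exists (n : nat) (P : 'I_n -> set R),
    [/\ partition [set: 'I_n] P J,
        forall i, is_interval (P i) &
        forall i x y, P i x -> P i y -> psi x = psi y].

(* The case split is needed because powR sets 0 `^ (- alpha) = 0 for
   alpha > 0, where the mathematical convention is +oo. *)
Definition riesz_kernel (R : realType) (alpha x y : R) : \bar R :=
  if (x == y) && (0 < alpha) then +oo%E else (`|x - y| `^ (- alpha))%:E.

Definition energy (R : realType) (mu : probability (measurableTypeR R) R)
    (alpha : R) : \bar R :=
  (\int[mu]_y \int[mu]_x riesz_kernel alpha x y)%E.

Definition correlation_dimension (R : realType)
    (mu : probability (measurableTypeR R) R) : \bar R :=
  ereal_sup [set alpha%:E | alpha in [set a : R | (energy mu a < +oo)%E]].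

(* Main.v *)
Require Import Defs.
From HB Require Import structures.
From mathcomp Require Import all_boot all_order all_algebra.
From mathcomp Require Import ring lra.
From mathcomp Require Import all_classical all_reals all_analysis.
From mathcomp Require Import measurable_realfun.

Import Order.TTheory GRing.Theory Num.Theory.
Import numFieldNormedType.Exports.

Local Open Scope classical_set_scope.
Local Open Scope ring_scope.

(* Write D for the diffusion operator and nu for the law of X - Y, with X and Y
   independent of law mu. Stationarity of mu says that D sends
   x |-> nu [x - rho, x + rho] to lambda^-alpha times the same function at
   scale lambda rho. For a large interval J = [-r, r], the indicator 1_J is at
   most 4 nu [x - 2r, x + 2r], so D^n 1_J (x) is at most
   4 lambda^(-n alpha) nu [x - 2r lambda^n, x + 2r lambda^n]. The balls of nu
   are, up to a factor 3, heaviest at 0, where finiteness of the energy at some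
   b > alpha gives nu [-rho, rho] <= rho^b I(mu, b). Hence D^n 1_J tends to 0
   uniformly. Once D^(n+1) 1_J < 1, the function psi = sum_(m <= n) D^m 1_J
   satisfies D psi = psi - 1_J + D^(n+1) 1_J < psi on J. *)

(** * Order, linearity and support properties of the diffusion operator and its iterates *)

Section diffusion.
Context {R : realType} {k : nat} (S : similarity_ifs R k) (alpha : R).
Local Notation la := (ifs_ratio S).
Local Notation c := (ifs_shift S).
Local Notation p := (ifs_weight S).
Local Notation D := (sym_diffusion alpha S).

Lemma sym_diffusion_le (f g : R -> R) :
  (forall x, f x <= g x) -> forall x, D f x <= D g x.
Proof.
move=> fg x; rewrite /sym_diffusion ler_wpM2l ?powR_ge0//.
apply: ler_sum => i _; apply: ler_sum => j _.
by rewrite ler_wpM2l// mulr_ge0// ltW// ifs_weight_gt0.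
Qed.

Lemma sym_diffusionZ (a : R) (f : R -> R) x :
  D (fun y => a * f y) x = a * D f x.
Proof.
rewrite /sym_diffusion mulrCA; congr (_ * _); rewrite mulr_sumr.
apply: eq_bigr => i _; rewrite mulr_sumr; apply: eq_bigr => j _.
by rewrite mulrCA.
Qed.

Lemma sym_diffusion_sum n (f : nat -> R -> R) x :
  D (fun y => \sum_(m < n) f m y) x = \sum_(m < n) D (f m) x.
Proof.
rewrite /sym_diffusion -mulr_sumr; congr (_ * _).
rewrite [RHS]exchange_big/=; apply: eq_bigr => i _.
rewrite [RHS]exchange_big/=; apply: eq_bigr => j _.
by rewrite mulr_sumr.
Qed.

Lemma sym_diffusion_cst (a : R) x : D (fun=> a) x = la `^ (- alpha) * a.
Proof.
rewrite /sym_diffusion; congr (_ * _).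
under eq_bigr => i _ do rewrite -mulr_suml -mulr_sumr (ifs_weight_sum1 S) mulr1.
by rewrite -mulr_suml (ifs_weight_sum1 S) mul1r.
Qed.

Lemma iter_sym_diffusion_le n (f g : R -> R) :
  (forall x, f x <= g x) -> forall x, iter n D f x <= iter n D g x.
Proof. by elim: n f g => [|n IH] f g fg//= x; apply: sym_diffusion_le; exact: IH. Qed.

Lemma iter_sym_diffusion_ge0 n (f : R -> R) :
  (forall x, 0 <= f x) -> forall x, 0 <= iter n D f x.
Proof.
move=> f0; elim: n => [|n IH]//= x.
by rewrite -[leLHS](mulr0 (la `^ (- alpha))) -(sym_diffusion_cst 0 x) sym_diffusion_le.
Qed.

Lemma iter_sym_diffusion_le_cst n (f : R -> R) (M : R) :
  (forall x, f x <= M) -> forall x, iter n D f x <= (la `^ (- alpha)) ^+ n * M.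
Proof.
move=> fM; elim: n => [|n IH] x /=; first by rewrite expr0 mul1r.
by rewrite exprS -mulrA -(sym_diffusion_cst _ x); exact: sym_diffusion_le.
Qed.

(** The value of [D f] at [x] only involves [f] at the points [(x - c i + c j) / la], and these stay
    outside [A] when [x] does. *)
Lemma iter_sym_diffusion_eq0 n (f : R -> R) (A : set R) :
  (forall i j x, ~ A x -> ~ A ((x - c i + c j) / la)) ->
  (forall x, ~ A x -> f x = 0) ->
  forall x, ~ A x -> iter n D f x = 0.
Proof.
move=> AS f0; elim: n => [|n IH]//= x Ax.
rewrite /sym_diffusion big1 ?mulr0// => i _; rewrite big1// => j _.
by rewrite IH ?mulr0//; exact: AS.
Qed.

(** Telescoping: [D] sends each iterate to the next, so the sum loses its first term and gains the
    [n]-th iterate. *)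
Lemma sym_diffusion_neumann n (f : R -> R) x :
  D (fun y => \sum_(m < n) iter m D f y) x =
  \sum_(m < n) iter m D f x - f x + iter n D f x.
Proof.
rewrite sym_diffusion_sum.
elim: n => [|n IH]; first by rewrite !big_ord0/= sub0r addNr.
by rewrite !big_ord_recr/= IH; ring.
Qed.

End diffusion.

(** * Piecewise constant functions described by finite lists of breakpoints *)

Section breakpoints.
Context {R : realType}.
Implicit Types (s : seq R) (f : R -> R) (x y t : R).

(** Testing both [<] and [<=] makes the breakpoints themselves singleton cells, next to the open
    gaps between them. *)
Definition same_cell s x y :=
  all (fun t => ((x < t) == (y < t)) && ((x <= t) == (y <= t))) s.

(** Stated on the whole line, so that it is stable under sums, scaling and affine substitution,
    hence under [sym_diffusion]; only at the end is it restricted to an interval. *)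
Definition finite_breakpoints f :=
  exists s, forall x y, same_cell s x y -> f x = f y.

Lemma same_cell_cat s1 s2 x y :
  same_cell (s1 ++ s2) x y = same_cell s1 x y && same_cell s2 x y.
Proof. exact: all_cat. Qed.

Lemma finite_breakpointsD f g : finite_breakpoints f -> finite_breakpoints g ->
  finite_breakpoints (fun x => f x + g x).
Proof.
move=> [s fs] [s' gs']; exists (s ++ s') => x y.
by rewrite same_cell_cat => /andP[/fs -> /gs' ->].
Qed.

Lemma finite_breakpointsZ a f : finite_breakpoints f ->
  finite_breakpoints (fun x => a * f x).
Proof. by move=> [s fs]; exists s => x y /fs ->. Qed.

Lemma finite_breakpoints_sum n (f : 'I_n -> R -> R) :
  (forall i, finite_breakpoints (f i)) ->
  finite_breakpoints (fun x => \sum_(i < n) f i x).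
Proof.
elim: n f => [|n IH] f fs.
  by exists [::] => x y _; rewrite !big_ord0.
have [s hs] := finite_breakpointsD _ _ (IH _ (fun i => fs (widen_ord (leqnSn n) i)))
  (fs ord_max).
by exists s => x y /hs; rewrite !big_ord_recr.
Qed.

Lemma finite_breakpoints_affine a b f : 0 < a -> finite_breakpoints f ->
  finite_breakpoints (fun x => f ((x + b) / a)).
Proof.
(* These are the preimages of the breakpoints under [x |-> (x + b) / a], which preserves order since
   [0 < a]. *)
move=> a0 [s fs]; exists [seq t * a - b | t <- s] => x y xy; apply: fs.
apply/allP => t ts.
have /= := allP xy _ (map_f (fun t => t * a - b) ts).
by rewrite !ltr_pdivrMr// !ler_pdivrMr// -!ltrBrDr -!lerBrDr.
Qed.

Lemma finite_breakpoints_indic a b : finite_breakpoints (\1_`[a, b] : R -> R).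
Proof.
exists [:: a; b] => x y /= /and3P[/andP[/eqP xa _] /andP[_ /eqP xb] _].
rewrite !indicE; congr ((_ : bool)%:R).
by apply/idP/idP; rewrite !inE/= !in_itv/= !leNgt xa -leNgt -(leNgt _ b) ?xb// -?xb leNgt -?leNgt.
Qed.

Lemma same_cell_order s x y z : x <= z <= y -> same_cell s x y -> same_cell s x z.
Proof.
move=> /andP[xz zy] /allP xy; apply/allP => t ts.
have /andP[/eqP lt_xy /eqP le_xy] := xy t ts.
apply/andP; split; apply/eqP; apply/idP/idP.
- by rewrite lt_xy; exact: le_lt_trans.
- exact: le_lt_trans.
- by rewrite le_xy; exact: le_trans.
- exact: le_trans.
Qed.

Lemma finite_breakpoints_piecewise_constant J f :
  is_interval J -> finite_breakpoints f -> piecewise_constant_on J f.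
Proof.
move=> itvJ [s fs].
(* The vector of comparisons with all breakpoints names the cell of [x] by an element of a finite
   type. *)
pose sg x : {ffun 'I_(size s) -> bool * bool} :=
  [ffun i : 'I_(size s) => (x < s`_i, x <= s`_i)].
have sgE x y : sg x = sg y -> same_cell s x y.
  move=> xy; apply/(all_nthP 0) => i ilt.
  have := congr1 (fun g : {ffun 'I_(size s) -> bool * bool} => g (Ordinal ilt)) xy.
  by rewrite !ffunE/= => -[-> ->]; rewrite !eqxx.
have Esg x y : same_cell s x y -> sg x = sg y.
  move=> xy; apply/ffunP => i; rewrite !ffunE.
  by have /andP[/eqP -> /eqP ->] := all_nthP 0 xy i (ltn_ord i).
(* Only vectors attained on [J] are kept, because the members of a [partition] must be nonempty. *)
pose A : {set {ffun 'I_(size s) -> bool * bool}} :=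
  [set v | `[< exists2 x, J x & sg x = v >]]%SET.
exists #|A|, (fun i => J `&` [set x | sg x = enum_val i]); split.
- split.
  + apply/seteqP; split => [x [i _ []]//|x Jx].
    have xA : sg x \in A by rewrite inE; apply/asboolP; exists x.
    by exists (enum_rank_in xA (sg x)) => //; split => //=; rewrite enum_rankK_in.
  + move=> i j _ _ [x [[_ /= xi] [_ /= xj]]].
    by apply: enum_val_inj; rewrite -xi -xj.
  + move=> i _; have := enum_valP i; rewrite inE => /asboolP[x Jx xi].
    by exists x; split.
- move=> i x y [Jx /= xi] [Jy /= yi] z xzy; split; first exact: (itvJ x y).
  by rewrite /= -xi; apply/esym/Esg/(same_cell_order _ _ _ _ xzy)/sgE; rewrite xi yi.
- by move=> i x y [_ /= xi] [_ /= yi]; apply/fs/sgE; rewrite xi yi.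
Qed.

Lemma finite_breakpoints_sym_diffusion k (S : similarity_ifs R k) alpha f :
  finite_breakpoints f -> finite_breakpoints (sym_diffusion alpha S f).
Proof.
move=> fs; apply: finite_breakpointsZ.
apply: finite_breakpoints_sum => i; apply: finite_breakpoints_sum => j.
apply: finite_breakpointsZ.
have [s hs] := finite_breakpoints_affine _ (ifs_shift S j - ifs_shift S i) _ (ifs_ratio_gt0 S) fs.
by exists s => x y /hs; rewrite !addrA (addrAC x) (addrAC y).
Qed.

End breakpoints.

(** * Ball masses of the law of X - Y and their comparison with the ball at the origin *)

Section correlation.
Context {R : realType} (mu : probability (measurableTypeR R) R).
Local Notation T := (measurableTypeR R).

Definition ball_mass (rho u : R) : \bar R := mu `[u - rho, u + rho]%classic.

(* The mass of [x - rho, x + rho] under the law of X - Y. *)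
Definition correlation_mass (rho x : R) : \bar R :=
  (\int[mu]_y ball_mass rho (x + y)%R)%E.

Lemma ball_mass_ge0 rho u : (0 <= ball_mass rho u)%E.
Proof. exact: measure_ge0. Qed.

Lemma ball_mass_le1 rho u : (ball_mass rho u <= 1)%E.
Proof. by apply: probability_le1; exact: measurable_itv. Qed.

Lemma measurable_ball_mass rho :
  measurable_fun [set: T] (ball_mass rho).
Proof.
(* The ball around [u] is the section at [u] of a measurable strip along the diagonal. *)
pose A : set (T * T) := (fun z => z.2 - z.1) @^-1` `[- rho, rho]%classic.
have mA : measurable A.
  rewrite -[A]setTI; apply: (_ : measurable_fun setT _) => //.
  apply: measurable_funB; [exact: measurable_snd|exact: measurable_fst].
have -> : ball_mass rho = mu \o xsection A; last exact: measurable_fun_xsection.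
apply/funext => u; rewrite /ball_mass/=; congr (mu _).
apply/seteqP; split=> y /=; rewrite /xsection/= inE/= /A/= !in_itv/= => /andP[h1 h2];
  apply/andP; split; lra.
Qed.

Lemma measurable_ball_massD rho (f : R -> R) :
  measurable_fun [set: T] f ->
  measurable_fun [set: T] (fun y => ball_mass rho (f y)).
Proof. move=> mf; exact: (measurableT_comp (measurable_ball_mass rho) mf). Qed.

Lemma measurable_translate (x : R) : measurable_fun [set: T] (fun y => x + y).
Proof. by apply: measurable_funD => //; exact: measurable_cst. Qed.

Lemma correlation_mass_ge0 rho x : (0 <= correlation_mass rho x)%E.
Proof. by apply: integral_ge0 => y _; exact: ball_mass_ge0. Qed.

Lemma correlation_mass_le1 rho x : (correlation_mass rho x <= 1)%E.
Proof.
rewrite -[leRHS](_ : (\int[mu]_y (cst 1 y) = 1)%E); last first.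
  by rewrite integral_cst// mul1e; exact: probability_setT.
apply: ge0_le_integral => //.
- by apply: measurable_ball_massD; exact: measurable_translate.
- by move=> y _; exact: ball_mass_le1.
Qed.

Lemma correlation_mass_fin_num rho x : correlation_mass rho x \is a fin_num.
Proof.
by rewrite ge0_fin_numE ?correlation_mass_ge0// (le_lt_trans (correlation_mass_le1 _ _))// ltry.
Qed.

Lemma probability_tight (eps : R) : 0 < eps ->
  exists n : nat, ((1 - eps)%:E <= mu `[(- n%:R)%R, n%:R%R]%classic)%E.
Proof.
move=> eps0.
pose F (n : nat) : set T := `[- n%:R, n%:R]%classic.
have UF : \bigcup_n F n = setT.
  apply/seteqP; split => // x _.
  exists (Num.truncn `|x|).+1 => //=.
  by rewrite /F/= in_itv/= -ler_norml ltW// truncnS_gt.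
have muUF : mu (\bigcup_n F n) = 1%E by rewrite UF; exact: probability_setT.
have : (mu \o F) n @[n --> \oo] --> 1%E.
  rewrite -muUF; apply: nondecreasing_cvg_mu.
  - by move=> n; exact: measurable_itv.
  - by rewrite UF.
  - move=> n m nm; apply/subsetPset => x/=; rewrite /F/= !in_itv/= -!ler_norml.
    by move/le_trans; apply; rewrite ler_nat.
move=> /fine_cvgP[] _ /cvgrPdist_le/(_ _ eps0)[N _ /(_ N (leqnn _))]/=.
have : mu (F N) \is a fin_num by apply: fin_num_measure; exact: measurable_itv.
move=> Ffin H; exists N; rewrite -/(F N) -(fineK Ffin) lee_fin.
by move: H; rewrite ler_norml => /andP[_]; lra.
Qed.

Definition grid_cell (t rho : R) (i : nat) : set T :=
  `[t + i%:R * rho, t + i.+1%:R * rho[%classic.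

Lemma measurable_grid_cell (t rho : R) i : measurable (grid_cell t rho i).
Proof. exact: measurable_itv. Qed.
#[local] Hint Resolve measurable_grid_cell : core.

Lemma trivIset_grid_cell (t rho : R) (A : set nat) : 0 < rho ->
  trivIset A (grid_cell t rho).
Proof.
move=> rho0 i j _ _ [x []]; rewrite /grid_cell/= !in_itv/= => /andP[xi xi'] /andP[xj xj'].
have lt_cell (a b : nat) : t + a%:R * rho <= x -> x < t + b.+1%:R * rho -> (a <= b)%N.
  move=> xa xb; rewrite -ltnS -(ltr_nat R) -(ltr_pM2r rho0); lra.
by apply/eqP; rewrite eqn_leq !lt_cell.
Qed.

Lemma bigcup_grid_cell (t rho : R) n : 0 < rho ->
  \big[setU/set0]_(i <- iota 0 n) grid_cell t rho i = `[t, t + n%:R * rho[%classic.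
Proof.
move=> rho0; rewrite -bigcup_seq; apply/seteqP; split => x.
- move=> [i /= ]; rewrite mem_iota add0n /= => iltn.
  rewrite /grid_cell/= !in_itv/= => /andP[h1 h2].
  have : i.+1%:R * rho <= n%:R * rho by rewrite ler_pM2r// ler_nat.
  have : 0 <= i%:R * rho by rewrite mulr_ge0// ltW.
  by move=> h3 h4; apply/andP; split; lra.
- rewrite /= in_itv/= => /andP[tx xt].
  have x0 : 0 <= (x - t) / rho by rewrite divr_ge0 ?subr_ge0// ltW.
  have /andP[h1 h2] := truncn_itv x0.
  exists (Num.truncn ((x - t) / rho)).
    rewrite /= mem_iota/= add0n -(ltr_nat R) (le_lt_trans h1)// ltr_pdivrMr//; lra.
  rewrite /grid_cell/= in_itv/=.
  move: h1 h2; rewrite ler_pdivlMr// ltr_pdivrMr// => h1 h2.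
  by apply/andP; split; lra.
Qed.

Lemma fine_measureK (A : set T) : measurable A -> (fine (mu A))%:E = mu A.
Proof. by move=> mA; rewrite fineK//; exact: fin_num_measure. Qed.

(** A squared cell mass is the probability that X and Y both fall in that cell, which forces |X - Y|
    <= [rho]; for distinct cells these events are disjoint. *)
Lemma sum_grid_cell_sqr_le (t rho : R) n : 0 < rho ->
  \sum_(i <- iota 0 n) fine (mu (grid_cell t rho i)) ^+ 2 <=
  fine (correlation_mass rho 0).
Proof.
move=> rho0; rewrite -lee_fin fineK ?correlation_mass_fin_num// -sumEFin.
have mG : measurable_fun [set: T] (fun y => ball_mass rho (0 + y)).
  by apply: measurable_ball_massD; exact: measurable_translate.
pose U := \big[setU/set0]_(i <- iota 0 n) grid_cell t rho i.
have mU : measurable U by rewrite /U bigcup_grid_cell//; exact: measurable_itv.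
apply: (@le_trans _ _ (\int[mu]_(y in U) ball_mass rho (0 + y))%E); last first.
  by apply: ge0_subset_integral => //; exact: measurableT.
rewrite ge0_integral_bigsetU ?iota_uniq//; last 2 first.
- exact: trivIset_grid_cell.
- exact: measurable_funTS.
apply: lee_sum => i _.
rewrite expr2 EFinM fine_measureK// -integral_cst//; apply: ge0_le_integral => //.
- exact: measurable_funTS.
- move=> y; rewrite /grid_cell/= in_itv/= => /andP[h1 h2].
  apply: le_measure; rewrite ?inE//.
  move=> z/=; rewrite !in_itv/= => /andP[h3 h4].
  have e1 : (i.+1%:R : R) = i%:R + 1 by rewrite natr1.
  rewrite e1 in h2 h4.
  by apply/andP; split; lra.
Qed.

(* For y in a cell of the grid of step rho, [x + y - rho, x + y + rho] is covered
   by three consecutive cells of a translated grid. This bounds the correlation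
   mass by three sums of products a_i b_i of cell masses, and
   2 a_i b_i <= a_i^2 + b_i^2 reduces them to sums of squares. The slack eps
   pays for the mass of mu outside a bounded union of cells. *)
Lemma correlation_mass_le_eps (rho x eps : R) : 0 < rho -> 0 < eps ->
  fine (correlation_mass rho x) <= 3 * fine (correlation_mass rho 0) + eps.
Proof.
move=> rho0 eps0; have [N muN] := probability_tight eps eps0.
have mG : measurable_fun [set: T] (fun y => ball_mass rho (x + y)).
  by apply: measurable_ball_massD; exact: measurable_translate.
pose t : R := - N%:R.
(* The successor makes [t + n * rho] exceed [N], so that the half-open [U] contains all of
   [[-N, N]]. *)
pose n := (Num.truncn ((N%:R - t) / rho)).+1.
pose U := `[t, t + n%:R * rho[%classic : set T.
have mU : measurable U by exact: measurable_itv.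
have muCU : (mu (~` U) <= eps%:E)%E.
  rewrite probability_setC// leeBlDl; last by rewrite fin_num_measure.
  rewrite -leeBlDr// -EFinB; apply: le_trans muN _; apply: le_measure; rewrite ?inE//.
  move=> y; rewrite /U/= !in_itv/= => /andP[h1 h2]; rewrite h1/= (le_lt_trans h2)//.
  by rewrite -ltrBlDl -ltr_pdivrMr// truncnS_gt.
(* The values 0, 1, 2 of [e] stand for the left neighbour, the translate by [x] of cell [i], and the
   right neighbour. For fixed [e] the [J e i] form one grid, to which [sum_grid_cell_sqr_le]
   applies. *)
pose J e i := grid_cell (x + t + (e%:R - 1) * rho) rho i.
have mJ e i : measurable (J e i) by exact: measurable_grid_cell.
have cellI i : (\int[mu]_(y in grid_cell t rho i) ball_mass rho (x + y) <=
    \sum_(e <- iota 0 3) (fine (mu (J e i)) * fine (mu (grid_cell t rho i)))%:E)%E.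
  rewrite (eq_bigr (fun e => mu (J e i) * mu (grid_cell t rho i))%E); last first.
    by move=> e _; rewrite EFinM !fine_measureK.
  rewrite -ge0_sume_distrl//; rewrite -integral_cst//; apply: ge0_le_integral => //.
  - exact: measurable_funTS.
  - move=> y; rewrite /grid_cell/= in_itv/= => /andP[h1 h2].
    rewrite /cst/= !big_cons big_nil adde0.
    apply: (@le_trans _ _ (mu (J 0 i `|` (J 1 i `|` J 2 i)))%N); last first.
      apply: le_trans (measureU2 _ _ _) _ => //; first exact: measurableU.
      by rewrite leeD2l// measureU2.
    apply: le_measure; rewrite ?inE//; first by do 2?apply: measurableU.
    have e1 : (i.+1%:R : R) = i%:R + 1 by rewrite natr1.
    move=> z; rewrite /J /grid_cell/= !in_itv/= e1 => /andP[h3 h4]; rewrite e1 in h2.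
    have [z0|z0] := ltP z (x + t + i%:R * rho).
      by left; apply/andP; split; lra.
    have [z1|z1] := ltP z (x + t + i%:R * rho + rho).
      by right; left; apply/andP; split; lra.
    by right; right; apply/andP; split; lra.
rewrite -lee_fin EFinD EFinM !fineK ?correlation_mass_fin_num//.
rewrite {1}/correlation_mass -(setUv U) ge0_integral_setU//; first last.
- by apply/disj_set2P; rewrite setICr.
- by rewrite setUv.
- exact: measurableC.
apply: leeD.
  rewrite /U -bigcup_grid_cell// ge0_integral_bigsetU ?iota_uniq//; last 2 first.
  - exact: trivIset_grid_cell.
  - exact: measurable_funTS.
  apply: (le_trans (lee_sum _ (fun i _ => cellI i))).
  under eq_bigr do rewrite sumEFin.
  rewrite sumEFin -(fineK (correlation_mass_fin_num rho 0)) -EFinM lee_fin exchange_big/=.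
  have -> : 3 * fine (correlation_mass rho 0) =
      \sum_(e <- iota 0 3) fine (correlation_mass rho 0).
    by rewrite /= !big_cons big_nil; lra.
  apply: ler_sum => e _.
  have h1 := sum_grid_cell_sqr_le t rho n rho0.
  have h2 := sum_grid_cell_sqr_le (x + t + (e%:R - 1) * rho) rho n rho0.
  rewrite -(ler_pM2l (ltr0Sn R 1)); apply: (@le_trans _ _
    (\sum_(i <- iota 0 n) (fine (mu (J e i)) ^+ 2 + fine (mu (grid_cell t rho i)) ^+ 2))).
    rewrite mulr_sumr; apply: ler_sum => i _.
    rewrite -subr_ge0; set a := fine _; set b := fine _.
    by rewrite (_ : _ - _ = (a - b) ^+ 2) ?sqr_ge0//; ring.
  by rewrite big_split/=; rewrite /J in h2 *; lra.
apply: le_trans muCU.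
rewrite -[leRHS]mul1e -integral_cst//; last exact: measurableC.
apply: ge0_le_integral => //; first exact: measurableC.
  exact: measurable_funTS.
by move=> y _; exact: ball_mass_le1.
Qed.

Lemma correlation_mass_le_origin (rho x : R) : 0 < rho ->
  fine (correlation_mass rho x) <= 3 * fine (correlation_mass rho 0).
Proof.
by move=> rho0; apply/ler_addgt0Pr => eps; exact: correlation_mass_le_eps.
Qed.

End correlation.

(** * Stationarity as a scaling relation between [D] and correlation masses *)

Section stationary.
Context {R : realType} {k : nat} (S : similarity_ifs R k).
Context (mu : probability (measurableTypeR R) R).
Context (mu_stationary : stationary_measure S mu).
Local Notation T := (measurableTypeR R).
Local Notation la := (ifs_ratio S).
Local Notation c := (ifs_shift S).
Local Notation p := (ifs_weight S).

Lemma measurable_ifs_map j : measurable_fun [set: T] (ifs_map S j : T -> T).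
Proof.
apply: measurable_funD; last exact: measurable_cst.
by apply: measurable_funM; [exact: measurable_cst|exact: measurable_id].
Qed.

Lemma stationary_integral (f : T -> \bar R) :
  measurable_fun [set: T] f -> (forall x, (0 <= f x)%E) ->
  (\int[mu]_x f x = \sum_(j < k) (p j)%:E * \int[mu]_x f (ifs_map S j x))%E.
Proof.
move=> mf f0.
pose F j : {mfun T >-> T} :=
  HB.pack (ifs_map S j : T -> T) (isMeasurableFun.Build _ _ _ _ _ (measurable_ifs_map j)).
pose w j : {nonneg R} := NngNum (ltW (ifs_weight_gt0 S j)).
(* [msum] takes a sequence indexed by [nat], so the family over ['I_k] is extended by the zero
   measure. *)
pose m (n : nat) : {measure set T -> \bar R} :=
  if insub n is Some j then mscale (w j) (distribution mu (F j)) else mzero.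
rewrite (eq_measure_integral (msum m k)); last first.
  move=> A mA _; apply: etrans (mu_stationary _ mA) _; apply: eq_bigr => j _.
  by rewrite /m valK.
rewrite ge0_integral_measure_sum//; apply: eq_bigr => j _.
rewrite /m valK ge0_integral_mscale//; congr (_ * _)%E.
exact: ge0_integral_distribution.
Qed.

Lemma ball_mass_stationary (rho u : R) :
  ball_mass mu rho u =
  (\sum_(i < k) (p i)%:E * ball_mass mu (rho / la) ((u - c i) / la))%E.
Proof.
have la0 := ifs_ratio_gt0 S.
apply: etrans (mu_stationary _ (measurable_itv _)) _.
apply: eq_bigr => i _; congr (_ * mu _)%E; apply/seteqP.
rewrite -mulrBl -mulrDl; split => x; rewrite /= !in_itv/= /ifs_map/=;
  rewrite ler_pdivrMr// ler_pdivlMr// => /andP[h1 h2]; apply/andP; split; lra.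
Qed.

(** Stationarity is used once for each variable: with X = [la] X' + [c i] and Y = [la] Y' + [c j],
    the event |X - Y - [x]| <= [rho] says that X' - Y' is within [rho / la] of
    [(x - c i + c j) / la]. These are the points and weights of the diffusion operator. *)
Lemma correlation_mass_stationary (rho x : R) :
  correlation_mass mu rho x =
  (\sum_(i < k) \sum_(j < k) (p i * p j)%:E *
     correlation_mass mu (rho / la) ((x - c i + c j) / la))%E.
Proof.
have la0 : la != 0 by rewrite gt_eqF// ifs_ratio_gt0.
have p0 i : (0 <= (p i)%:E)%E by rewrite lee_fin ltW// ifs_weight_gt0.
have mb i (r : R) (g : T -> T) : measurable_fun setT g ->
    measurable_fun setT (fun y => (p i)%:E * ball_mass mu r (g y))%E.
  by move=> mg; apply: measurable_funeM; exact: measurable_ball_massD.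
have mt i : measurable_fun [set: T] (fun y => (x + y - c i) / la).
  apply: measurable_funM; last exact: measurable_cst.
  by apply: measurable_funB; [exact: measurable_translate|exact: measurable_cst].
rewrite /correlation_mass; under eq_integral do rewrite ball_mass_stationary.
rewrite ge0_integral_sum//; last 2 first.
- by move=> i; exact: (mb _ _ _ (mt i)).
- by move=> i y _; rewrite mule_ge0// ball_mass_ge0.
apply: eq_bigr => i _; rewrite ge0_integralZl//; last exact: (measurable_ball_massD _ _ _ (mt i)).
rewrite stationary_integral//; last exact: (measurable_ball_massD _ _ _ (mt i)).
rewrite ge0_sume_distrr; last first.
  by move=> j _; rewrite mule_ge0// integral_ge0.
apply: eq_bigr => j _; rewrite EFinM muleA; congr (_ * _)%E.
apply: eq_integral => y _; congr (ball_mass _ _ _).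
by rewrite /ifs_map; field.
Qed.

Lemma sym_diffusion_correlation_mass (alpha rho x : R) :
  sym_diffusion alpha S (fun y => fine (correlation_mass mu rho y)) x =
  la `^ (- alpha) * fine (correlation_mass mu (la * rho) x).
Proof.
rewrite /sym_diffusion; congr (_ * _); apply: EFin_inj.
rewrite fineK ?correlation_mass_fin_num// correlation_mass_stationary -sumEFin.
apply: eq_bigr => i _; rewrite -sumEFin; apply: eq_bigr => j _.
rewrite EFinM fineK ?correlation_mass_fin_num//; congr (_ * correlation_mass _ _ _)%E.
by rewrite mulrAC divff ?mul1r// gt_eqF// ifs_ratio_gt0.
Qed.

Lemma iter_sym_diffusion_correlation_mass (alpha rho x : R) n :
  iter n (sym_diffusion alpha S) (fun y => fine (correlation_mass mu rho y)) x =
  (la `^ (- alpha)) ^+ n * fine (correlation_mass mu (la ^+ n * rho) x).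
Proof.
elim: n x => [|n IH] x; first by rewrite !expr0 !mul1r.
rewrite iterS (_ : iter _ _ _ = fun y => (la `^ (- alpha)) ^+ n *
  fine (correlation_mass mu (la ^+ n * rho) y)); last exact/funext.
by rewrite sym_diffusionZ sym_diffusion_correlation_mass mulrA -exprSr mulrA -exprS.
Qed.

End stationary.

(** * Upper bound of correlation masses by the energy, and a lower bound for large radii *)

Section energy.
Context {R : realType} (mu : probability (measurableTypeR R) R).
Local Notation T := (measurableTypeR R).

Lemma riesz_kernel_ge0 (a x y : R) : (0 <= riesz_kernel a x y)%E.
Proof. by rewrite /riesz_kernel; case: ifP => // _; rewrite lee_fin powR_ge0. Qed.

Lemma measurable_riesz_kernel (a : R) : measurable_fun [set: T * T]
  (fun z => riesz_kernel a z.1 z.2).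
Proof.
pose g (t : T) : \bar R := if (t == 0) && (0 < a) then +oo%E else (`|t| `^ (- a))%:E.
have -> : (fun z : T * T => riesz_kernel a z.1 z.2) = g \o (fun z => z.1 - z.2).
  by apply/funext => z; rewrite /riesz_kernel /g/= subr_eq0.
apply: measurableT_comp; last first.
  by apply: measurable_funB; [exact: measurable_fst|exact: measurable_snd].
apply: measurable_fun_ifT => //.
- apply: measurable_and; last exact: measurable_cst.
  by apply: measurable_fun_eqr; [exact: measurable_id|exact: measurable_cst].
- apply/measurable_EFinP; apply: (measurableT_comp (measurable_powR _)).
  exact: normr_measurable.
Qed.

(** Markov's inequality: the Riesz kernel is at least [rho] to the power [- a] wherever |x - y| <=
    [rho]. *)
Lemma correlation_mass_le_energy (a rho : R) : 0 < a -> 0 < rho ->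
  (correlation_mass mu rho 0 <= (rho `^ a)%:E * energy mu a)%E.
Proof.
move=> a0 rho0.
have mK y : measurable_fun [set: T] (fun x => riesz_kernel a x y).
  exact: (measurableT_comp (measurable_riesz_kernel a) (pair2_measurable y)).
have mI : measurable_fun [set: T] (fun y => \int[mu]_x riesz_kernel a x y)%E.
  apply: (@measurable_fun_fubini_tonelli_G _ _ T T R mu (fun z => riesz_kernel a z.1 z.2)).
    exact: measurable_riesz_kernel.
  by move=> z; exact: riesz_kernel_ge0.
have I0 y : (0 <= \int[mu]_x riesz_kernel a x y)%E.
  by apply: integral_ge0 => x _; exact: riesz_kernel_ge0.
rewrite /correlation_mass /energy -ge0_integralZl//; last by rewrite lee_fin powR_ge0.
apply: ge0_le_integral => //.
- by apply: measurable_ball_massD; exact: measurable_translate.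
- exact: measurable_funeM.
move=> y _; rewrite add0r.
have mB : measurable (`[y - rho, y + rho]%classic : set T) by exact: measurable_itv.
rewrite -ge0_integralZl//; last 2 first.
- by move=> x _; exact: riesz_kernel_ge0.
- by rewrite lee_fin powR_ge0.
rewrite /ball_mass -[leLHS]mul1e -integral_cst//.
have mrK : measurable_fun [set: T] (fun x => (rho `^ a)%:E * riesz_kernel a x y)%E.
  exact: measurable_funeM.
have rK0 x : (0 <= (rho `^ a)%:E * riesz_kernel a x y)%E.
  by rewrite mule_ge0// ?lee_fin ?powR_ge0// riesz_kernel_ge0.
apply: (@le_trans _ _ (\int[mu]_(x in `[(y - rho)%R, (y + rho)%R]%classic)
    ((rho `^ a)%:E * riesz_kernel a x y))%E); last first.
  by apply: ge0_subset_integral => //; exact: measurableT.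
apply: ge0_le_integral => //; first exact: measurable_funTS.
move=> x /=; rewrite in_itv/= => /andP[h1 h2].
(* On the diagonal the kernel is [+oo] and its factor is positive, so the bound is trivial there. *)
rewrite /riesz_kernel a0 andbT; case: eqP => [_|xy].
  by rewrite gt0_muley ?leey// lte_fin powR_gt0.
rewrite -EFinM lee_fin powRN; rewrite ler_pdivlMr ?mul1r.
  have xyrho : `|x - y| <= rho by rewrite ler_norml; apply/andP; split; lra.
  by rewrite ge0_ler_powR// ?nnegrE// ltW.
by rewrite powR_gt0// normr_gt0 subr_eq0; apply/eqP.
Qed.

(** If X and Y both lie in [[- (r / 2), r / 2]], then |X - Y| <= [r], hence |X - Y - [x]| <=
    [2 * r]. *)
Lemma correlation_mass_ge (r x : R) : `|x| <= r ->
  fine (mu `[- (r / 2), r / 2]%classic) ^+ 2 <= fine (correlation_mass mu (2 * r) x).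
Proof.
move=> xr; set B := `[_, _]%classic.
have mB : measurable (B : set T) by exact: measurable_itv.
rewrite -lee_fin fineK ?correlation_mass_fin_num// expr2 EFinM fine_measureK//.
rewrite -integral_cst// /correlation_mass.
have mG : measurable_fun [set: T] (fun y => ball_mass mu (2 * r) (x + y)).
  by apply: measurable_ball_massD; exact: measurable_translate.
apply: (@le_trans _ _ (\int[mu]_(y in B) ball_mass mu (2 * r) (x + y))%E); last first.
  by apply: ge0_subset_integral => //; exact: measurableT.
apply: ge0_le_integral => //; first exact: measurable_funTS.
move=> y; rewrite /B/= in_itv/= => /andP[h1 h2].
apply: le_measure; rewrite ?inE//.
move=> z/=; rewrite !in_itv/= => /andP[h3 h4].
by move: xr; rewrite ler_norml => /andP[h5 h6]; apply/andP; split; lra.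
Qed.

End energy.

(** * Geometric decay of the iterates of the indicator *)

Section decay.
Context {R : realType} {k : nat} (S : similarity_ifs R k).
Context (mu : probability (measurableTypeR R) R).
Context (mu_stationary : stationary_measure S mu).
Local Notation la := (ifs_ratio S).

(** The constant 12 is 4 times 3: 4 inverts the squared mass 1/4 when the indicator is dominated by
    a correlation mass, and 3 is the cost of moving the ball to the origin. *)
Lemma iter_sym_diffusion_indic_le (alpha a r : R) n x :
  0 < a -> 0 < r -> (energy mu a < +oo)%E ->
  1 / 2 <= fine (mu `[- (r / 2), r / 2]%classic) ->
  iter n (sym_diffusion alpha S) \1_`[- r, r] x <=
  12 * fine (energy mu a) * (2 * r) `^ a * (la `^ (a - alpha)) ^+ n.
Proof.
move=> a0 r0 Eoo mur; have la0 := ifs_ratio_gt0 S.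
have E0 : (0 <= energy mu a)%E.
  by apply: integral_ge0 => y _; apply: integral_ge0 => z _; exact: riesz_kernel_ge0.
have lan0 : 0 < la ^+ n by rewrite exprn_gt0.
have lan20 : 0 < la ^+ n * (2 * r) by rewrite mulr_gt0// mulr_gt0.
pose F y := 4 * fine (correlation_mass mu (2 * r) y).
have F1 y : \1_`[- r, r]%classic y <= F y.
  rewrite indicE; case: (boolP (y \in _)) => [|_].
    rewrite inE/= in_itv/= -ler_norml => /(correlation_mass_ge mu).
    have : (1 / 2) ^+ 2 <= fine (mu `[- (r / 2), r / 2]%classic) ^+ 2.
      by rewrite lerXn2r// nnegrE//; lra.
    by rewrite /F/= expr2; lra.
  by rewrite mulr_ge0// fine_ge0// correlation_mass_ge0.
apply: le_trans (iter_sym_diffusion_le _ _ n _ _ F1 x) _.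
have -> : iter n (sym_diffusion alpha S) F x = 4 * ((la `^ (- alpha)) ^+ n *
    fine (correlation_mass mu (la ^+ n * (2 * r)) x)).
  rewrite -iter_sym_diffusion_correlation_mass//.
  elim: n x {lan0 lan20} => //= n IH x; rewrite -sym_diffusionZ.
  by congr sym_diffusion; apply/funext.
have := correlation_mass_le_origin mu _ x lan20.
have : fine (correlation_mass mu (la ^+ n * (2 * r)) 0) <=
    (la ^+ n * (2 * r)) `^ a * fine (energy mu a).
  rewrite -lee_fin EFinM !fineK ?correlation_mass_fin_num//; last by rewrite ge0_fin_numE.
  exact: correlation_mass_le_energy.
rewrite powRM ?(ltW lan0)//; last by rewrite mulr_ge0// ltW.
have -> : (la ^+ n) `^ a = (la `^ a) ^+ n.
  by rewrite -!powR_mulrn ?powR_ge0 ?(ltW la0)// -!powRrM mulrC.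
have -> : la `^ (a - alpha) = la `^ (- alpha) * la `^ a.
  by rewrite addrC powRD// (gt_eqF la0) implybT.
rewrite exprMn => h1 h2.
have h3 : 0 <= (la `^ (- alpha)) ^+ n by rewrite exprn_ge0// powR_ge0.
have h4 := le_trans h2 (ler_wpM2l (ler0n R 3) h1).
have h5 := ler_wpM2l h3 h4.
move: h5; set s := _ ^+ n; set t := _ `^ a; set v := (_ `^ a) ^+ n.
set e := fine _; set f := fine _; lra.
Qed.

End decay.

(** * The finite Neumann sum as the function [psi] *)

Section truncated_neumann.
Context {R : realType} {k : nat} (S : similarity_ifs R k) (alpha : R).
Local Notation la := (ifs_ratio S).
Local Notation c := (ifs_shift S).

Lemma truncated_neumann_supersolution (a b : R) n :
  (forall i j x, ~ (`[a, b]%classic x) -> ~ (`[a, b]%classic ((x - c i + c j) / la))) ->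
  (forall x, iter n.+1 (sym_diffusion alpha S) \1_`[a, b] x < 1) ->
  let J := `[a, b]%classic in
  exists psi : R -> R,
    [/\ (forall x, 0 <= psi x) /\ piecewise_constant_on J psi,
        forall x, ~ J x -> psi x = 0,
        exists m M : R, 0 < m /\ (forall x, J x -> m <= psi x <= M) &
        forall x, J x -> sym_diffusion alpha S psi x < psi x].
Proof.
move=> invJ small J.
pose u m := iter m (sym_diffusion alpha S) (\1_J : R -> R).
have indic0 x : 0 <= (\1_J x : R) by rewrite indicE.
have indic1 x : (\1_J x : R) <= 1 by rewrite indicE; case: (_ \in _).
have u0 m x : 0 <= u m x by exact: iter_sym_diffusion_ge0.
have indicJ x : J x -> \1_J x = 1 :> R by move=> Jx; rewrite indicE mem_set.
exists (fun x => \sum_(m < n.+1) u m x); split.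
- split=> [x|]; first exact: sumr_ge0.
  apply: finite_breakpoints_piecewise_constant; first exact: interval_is_interval.
  apply: finite_breakpoints_sum => -[m _]/=.
  elim: m => [|m IH]; first exact: finite_breakpoints_indic.
  exact: finite_breakpoints_sym_diffusion.
- move=> x Jx; rewrite big1// => m _.
  apply: (iter_sym_diffusion_eq0 _ _ _ _ _ invJ) => // y Jy.
  by rewrite indicE memNset.
(* The term [m = 0] is the indicator, which is 1 on [J] and gives the lower bound; each iterate is
   at most its value on the constant 1, which gives the upper bound. *)
- exists 1, (\sum_(m < n.+1) (la `^ (- alpha)) ^+ m * 1); split=> // x Jx.
  apply/andP; split; last by apply: ler_sum => m _; exact: iter_sym_diffusion_le_cst.
  rewrite big_ord_recl /u/= indicJ// lerDl; apply: sumr_ge0 => m _; exact: (u0 (lift ord0 m)).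
- move=> x Jx; rewrite sym_diffusion_neumann indicJ//.
  by have := small x; rewrite -/J /u; lra.
Qed.

End truncated_neumann.

(** * Choice of the interval and proof of the theorem *)

(** The witness [[- a, a]] is mapped into itself because [la * a + C <= a], and its differences stay
    in [[- (2 * a), 2 * a]], which is closed and lies inside the open interval of radius [r]. *)
Lemma symmetric_itv_admissible (R : realType) (k : nat) (S : similarity_ifs R k) (C a r : R) :
  (forall j, `|ifs_shift S j| <= C) -> 0 <= a -> ifs_ratio S * a + C <= a -> 2 * a < r ->
  admissible S `[- r, r]%classic.
Proof.
move=> cC a0 aC ar; have la0 := ifs_ratio_gt0 S.
split; first exact: interval_is_interval.
exists `[- a, a]%classic; split.
- exact: interval_is_interval.
- by exists 0; rewrite /= in_itv/= a0 oppr_le0 a0.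
- move=> j _ [x /= ] + <-; rewrite /ifs_map !in_itv/= -!ler_norml => xa.
  apply: le_trans (ler_normD _ _) _; apply: le_trans aC; apply: lerD => //.
  by rewrite normrM gtr0_norm// ler_pM2l.
- have sub : closure [set x - y | x in `[- a, a]%classic & y in `[- a, a]%classic] `<=`
      `[- (2 * a), 2 * a]%classic.
    rewrite [X in _ `<=` X](closure_id _).1; last exact: interval_closed.
    apply: closure_subset => _ [x /= + [y /= + <-]]; rewrite !in_itv/=.
    by move=> /andP[h1 h2] /andP[h3 h4]; apply/andP; split; lra.
  apply: subset_trans sub _; rewrite interior_itv.
  by move=> x/=; rewrite !in_itv/= => /andP[h1 h2]; apply/andP; split; lra.
Qed.

(** By contraposition: if the rescaled point lies in the interval, then |x| <= [la * r + 2 * C].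
    This keeps [psi] supported in [J]. *)
Lemma symmetric_itv_backward_invariant (R : realType) (k : nat) (S : similarity_ifs R k) (C r : R) :
  (forall j, `|ifs_shift S j| <= C) -> ifs_ratio S * r + 2 * C <= r ->
  forall i j x, ~ (`[- r, r]%classic x) ->
    ~ (`[- r, r]%classic ((x - ifs_shift S i + ifs_shift S j) / ifs_ratio S)).
Proof.
move=> cC rC i j x; have la0 := ifs_ratio_gt0 S; apply: contra_not => /=.
rewrite !in_itv/= ler_pdivrMr// ler_pdivlMr// => /andP[h1 h2].
have := cC i; have := cC j; rewrite !ler_norml => /andP[h3 h4] /andP[h5 h6].
by apply/andP; split; lra.
Qed.

Theorem theorem1p19 (R : realType) (k : nat) (S : similarity_ifs R k)
    (mu : probability (measurableTypeR R) R)
    (mu_stationary : stationary_measure S mu)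
    (alpha : R) (alpha_gt0 : 0 < alpha)
    (alpha_lt : (alpha%:E < correlation_dimension mu)%E) :
  exists (J : set R) (psi : R -> R),
    [/\ admissible S J /\ compact J,
        (forall x, 0 <= psi x) /\ piecewise_constant_on J psi,
        forall x, ~ J x -> psi x = 0,
        exists m M : R, 0 < m /\ (forall x, J x -> m <= psi x <= M) &
        forall x, J x -> sym_diffusion alpha S psi x < psi x].
Proof.
have [_ [b energy_b <-]] := ereal_sup_gt alpha_lt.
rewrite lte_fin => alpha_b; have b0 : 0 < b by exact: lt_trans alpha_b.
have la0 := ifs_ratio_gt0 S; have la1 := ifs_ratio_lt1 S.
set la := ifs_ratio S in la0 la1.
pose C : R := \sum_j `|ifs_shift S j|.
have cC j : `|ifs_shift S j| <= C.
  by rewrite /C (bigD1 j)//= lerDl sumr_ge0.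
have C0 : 0 <= C by exact: sumr_ge0.
(* The fixed point of [a = la * a + C], the equality case of the invariance condition. *)
pose a := C / (1 - la).
have aE : C = a * (1 - la) by rewrite /a divfK// gt_eqF// subr_gt0.
have a0 : 0 <= a by rewrite divr_ge0// subr_ge0 ltW.
have [N muN] := probability_tight mu (1 / 2) ltac:(lra).
have N0 : 0 <= N%:R :> R by [].
(* Three demands are met: [2 * a < r] for admissibility, [N <= r / 2] for half of the mass, and
   [2 * C = 2 * a * (1 - la) <= r * (1 - la)] for backward invariance. *)
pose r := 2 * a + 2 * N%:R + 1.
have r0 : 0 < r by rewrite /r; lra.
have mur : 1 / 2 <= fine (mu `[- (r / 2), r / 2]%classic).
  rewrite -lee_fin fine_measureK; last exact: measurable_itv.
  apply: le_trans (_ : (mu `[(- N%:R)%R, N%:R%R]%classic <= _)%E).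
    by apply: le_trans muN; rewrite lee_fin; lra.
  apply: le_measure; rewrite ?inE//; try exact: measurable_itv.
  by move=> x/=; rewrite !in_itv/= => /andP[h1 h2]; apply/andP; split; rewrite /r; lra.
pose K := 12 * fine (energy mu b) * (2 * r) `^ b.
pose q := la `^ (b - alpha).
have K0 : 0 <= K.
  rewrite !mulr_ge0 ?powR_ge0// fine_ge0//.
  by apply: integral_ge0 => y _; apply: integral_ge0 => z _; exact: riesz_kernel_ge0.
have q01 : 0 <= q < 1.
  rewrite powR_ge0/=; have <- : 1 `^ (b - alpha) = 1 by rewrite powR1.
  by rewrite gt0_ltr_powR ?subr_gt0// nnegrE ltW.
have [n Kqn] : exists n, K * q ^+ n.+1 < 1.
  have /andP[q0 q1] := q01.
  have : q ^+ m @[m --> \oo] --> 0 by apply: cvg_expr; rewrite ger0_norm.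
  (* The threshold uses [K + 1] because [K] may be zero. *)
  move=> /cvgr0Pnorm_lt/(_ (K + 1)^-1)[|n _ /(_ n.+1 (leqnSn n))/=].
    by rewrite invr_gt0; lra.
  rewrite ger0_norm ?exprn_ge0// -[_^-1]mul1r ltr_pdivlMr; last lra.
  move=> qn; exists n; apply: le_lt_trans qn; rewrite mulrC ler_wpM2l ?exprn_ge0//; lra.
have [] := @truncated_neumann_supersolution R k S alpha (- r) r n.
- apply: (symmetric_itv_backward_invariant _ _ _ C) => //.
  rewrite -/la aE /r; have := mulr_ge0 (_ : 0 <= 1 - la) N0; nra.
- move=> x; apply: le_lt_trans Kqn.
  exact: iter_sym_diffusion_indic_le.
move=> psi [h1 h2 h3 h4]; exists `[- r, r]%classic, psi; split=> //.
split; last exact: segment_compact.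
apply: (symmetric_itv_admissible _ _ _ C a) => //; last by rewrite /r; lra.
by rewrite -/la aE; lra.
Qed.
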